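(* For all sufficiently small $\alpha > 0$ (that is, there is $\alpha_0>0$ such that for all $0<\alpha<\alpha_0$) we have $$F\left(\frac{\pi}{2} - \alpha\right) \le 2 - \alpha^2.$$
   Context: For a positive integer $d$ and a real number $\beta$, $f(d,\beta)$ denotes the size of the largest set of points in $\mathbb{R}^d$ with no three (distinct) points forming an angle at least $\beta$; that is, the largest size of a set $X\subset\mathbb{R}^d$ such that for all distinct $x,y,z\in X$ the angle at $x$ between the vectors $y-x$ and $z-x$ is strictly less than $\beta$. Put $$F(\beta) := \limsup_{d \to \infty} f(d, \beta)^{1/d}.$$ *)

(* Defs.v *)
From HB Require Import structures.
From mathcomp Require Import all_boot all_order all_algebra.
From mathcomp Require Import all_classical all_reals all_analysis.

Set Implicit Arguments.
Unset Strict Implicit.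
Unset Printing Implicit Defensive.

Import Order.TTheory GRing.Theory Num.Theory.
Import numFieldNormedType.Exports.

Local Open Scope classical_set_scope.
Local Open Scope ring_scope.

Definition dotp (R : realType) (d : nat) (u v : 'rV[R]_d) : R :=
  \sum_(i < d) u 0 i * v 0 i.

(* The library norm on ['rV[R]_d] is the sup norm, hence this definition. *)
Definition enorm (R : realType) (d : nat) (u : 'rV[R]_d) : R :=
  Num.sqrt (dotp u u).

(* The angle at [x], in [0, pi]; meaningful only for [y != x] and [z != x]. *)
Definition angle (R : realType) (d : nat) (x y z : 'rV[R]_d) : R :=
  acos (dotp (y - x) (z - x) / (enorm (y - x) * enorm (z - x))).

Definition angles_lt (R : realType) (d : nat) (beta : R) (X : set 'rV[R]_d) :
    Prop :=
  forall x y z : 'rV[R]_d, X x -> X y -> X z ->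
    x != y -> x != z -> y != z -> angle x y z < beta.

(* Extended-real valued, so that the value is +oo (and not a default one) when
   the admissible sets have unbounded size; [counting X] is the number of
   elements of [X], and +oo if [X] is infinite. *)
Definition maxsize (R : realType) (d : nat) (beta : R) : \bar R :=
  ereal_sup [set counting X | X in [set X : set 'rV[R]_d | angles_lt beta X]].

(* The term [d = 0] plays no role in the limit superior. *)
Definition growth (R : realType) (beta : R) : \bar R :=
  limn_esup (fun d : nat => poweR (maxsize d beta) (d%:R^-1)).

(* Main.v *)
Require Import Defs.
From mathcomp Require Import all_boot all_order all_algebra.
From mathcomp Require Import all_classical all_reals all_analysis.
From mathcomp Require Import ring lra zify.

(* This sharpens the argument of Danzer and Gruenbaum. Let all angles of a finite
   set S be less than pi/2 - a, and put s = sin a. In a triangle of S, the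
   projection of [y - z] on the direction of [y - x] has length at least s times
   |y - z|, which is itself at least s times the sum of the other two sides;
   this yields
     (y - z).(y - x) >= kappa |y - x|^2   with kappa = 9/5 s^2.
   To a word x_1 x_2 ... over S without equal consecutive letters we associate
   the point sum_i (1 - lam) lam^(i-1) x_i, where lam = 1/(2 - g) is slightly
   larger than 1/2. Consecutive letters being distinct, each such convex
   combination p gives weight at least lam/(1 + lam) > 1/3 to the letters other
   than y, so (y - p).(y - x) >= kappa/3 |y - x|^2. When g < 2/3 kappa, this depth
   shows that the points of two words with distinct first letters x and y are
   separated in the direction of y - x, hence the points of distinct words of
   length n are at distance at least c lam^n. They lie in a fixed box, so there
   are O(lam^(-nd)) of them, although there are at least (|S| - 1)^n words.
   Hence |S| - 1 <= (2 - g)^d, and g can be chosen larger than a^2. *)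

Set Implicit Arguments.
Unset Strict Implicit.
Unset Printing Implicit Defensive.
Import Order.TTheory GRing.Theory Num.Theory.
Local Open Scope ring_scope.

(** * Euclidean geometry: dot products, angles and triangles *)

Section DotProduct.
Context {R : realType} {d : nat}.
Implicit Types (u v w x y z : 'rV[R]_d) (a : R).

Lemma dotpC u v : dotp u v = dotp v u.
Proof. by apply: eq_bigr => i _; rewrite mulrC. Qed.

Lemma dotpDl u v w : dotp (u + v) w = dotp u w + dotp v w.
Proof. by rewrite -big_split; apply: eq_bigr => i _; rewrite mxE mulrDl. Qed.

Lemma dotpZl a u v : dotp (a *: u) v = a * dotp u v.
Proof. by rewrite mulr_sumr; apply: eq_bigr => i _; rewrite mxE mulrA. Qed.

Lemma dotpNl u v : dotp (- u) v = - dotp u v.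
Proof. by rewrite -scaleN1r dotpZl mulN1r. Qed.

Lemma dotpBl u v w : dotp (u - v) w = dotp u w - dotp v w.
Proof. by rewrite dotpDl dotpNl. Qed.

Lemma dotpBr u v w : dotp u (v - w) = dotp u v - dotp u w.
Proof. by rewrite dotpC dotpBl !(dotpC u). Qed.

Lemma dotpNr u v : dotp u (- v) = - dotp u v.
Proof. by rewrite dotpC dotpNl dotpC. Qed.

Lemma dotp0l u : dotp 0 u = 0.
Proof. by rewrite -(scale0r 0) dotpZl mul0r. Qed.

Lemma dotp_ge0 u : 0 <= dotp u u.
Proof. by apply: sumr_ge0 => i _; rewrite -expr2 sqr_ge0. Qed.

Lemma dotp_gt0 u : u != 0 -> 0 < dotp u u.
Proof.
move=> u0; rewrite lt_def dotp_ge0 andbT; apply: contra u0.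
rewrite psumr_eq0 => [/allP uu0|i _]; last by rewrite -expr2 sqr_ge0.
apply/eqP/rowP => i; rewrite mxE; apply/eqP.
by have := uu0 i (mem_index_enum i); rewrite /= mulf_eq0 orbb.
Qed.

Lemma enorm_sqr u : enorm u ^+ 2 = dotp u u.
Proof. by rewrite sqr_sqrtr ?dotp_ge0. Qed.

Lemma enorm_gt0 u : u != 0 -> 0 < enorm u.
Proof. by move=> u0; rewrite sqrtr_gt0 dotp_gt0. Qed.

Lemma cosine_itv u v : u != 0 -> v != 0 ->
  -1 <= dotp u v / (enorm u * enorm v) <= 1.
Proof.
move=> /enorm_gt0 u0 /enorm_gt0 v0; set t := (X in -1 <= X <= 1).
have tE : dotp u v = t * (enorm u * enorm v).
  by rewrite divfK// mulf_neq0 ?gt_eqF.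
have uE := enorm_sqr u; have vE := enorm_sqr v.
(* Cauchy-Schwarz: these squared lengths are [2 (1 - t)] and [2 (1 + t)] times [(|u| |v|)^2]. *)
have := dotp_ge0 (enorm v *: u - enorm u *: v).
have := dotp_ge0 (enorm v *: u - (- enorm u) *: v).
rewrite !dotpBl !dotpBr !dotpZl ![dotp _ (_ *: _)]dotpC !dotpZl.
rewrite (dotpC v u) tE -uE -vE => h1 h2.
have p : 0 < (enorm u * enorm v) ^+ 2 by rewrite exprn_gt0// mulr_gt0.
have {}h1 : 0 <= (1 + t) * (enorm u * enorm v) ^+ 2 by lra.
have {}h2 : 0 <= (1 - t) * (enorm u * enorm v) ^+ 2 by lra.
rewrite !pmulr_lge0// in h1 h2; lra.
Qed.

Lemma sin_lt_cosine a x y z : 0 < a < pi / 2 -> y != x -> z != x ->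
  angle x y z < pi / 2 - a ->
  sin a * (enorm (y - x) * enorm (z - x)) <= dotp (y - x) (z - x).
Proof.
move=> /andP[a0 a2]; rewrite -!(subr_eq0 _ x) => yx zx.
have t1 := cosine_itv yx zx; rewrite /angle => lt.
move: lt; rewrite -ltr_cos ?in_itv/= ?acos_ge0 ?acos_lepi//; last first.
  by have := pi_gt0 R; lra.
rewrite acosK ?in_itv//= -cosN opprB cosBpihalf => /ltW.
by rewrite ler_pdivlMr// mulr_gt0 ?enorm_gt0.
Qed.
End DotProduct.

(* A triangle with side lengths [A], [B], [C], all of whose angles have cosine at
   least [s]; [T / A] is the length of the projection of the side [C] on the
   side [A]. *)
Lemma triangle_projection {R : realType} (A B C T s : R) :
  0 < A -> 0 < B -> 0 < C -> 0 <= s -> s ^+ 2 <= 10^-1 ->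
  2 * T = A ^+ 2 + C ^+ 2 - B ^+ 2 ->
  s * (A * C) <= T -> s * (A * B) <= A ^+ 2 - T -> s * (B * C) <= C ^+ 2 - T ->
  9/5 * s ^+ 2 * A ^+ 2 <= T.
Proof.
move=> A0 B0 C0 s0 s2 TE hT hA hC.
(* The projections of the sides [A] and [B] on the side [C] add up to [C]. *)
have CAB : s * (A + B) <= C.
  have : s * (A + B) * C <= C * C by lra.
  by rewrite ler_pM2r.
have TAB : s ^+ 2 * A * (A + B) <= T.
  have : s * A * (s * (A + B)) <= s * A * C by rewrite ler_wpM2l// mulr_ge0// ltW.
  lra.
rewrite leNgt; apply/negP => Tlt.
(* By the law of cosines, [B^2 >= A^2 - 2 T >= (1 - 18/50) A^2 = (4/5 A)^2]; then [A + B >= 9/5 A]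
   in [TAB] contradicts [Tlt]. *)
have : (4/5 * A) ^+ 2 <= B ^+ 2.
  have := sqr_ge0 C; have : s ^+ 2 * A ^+ 2 <= 10^-1 * A ^+ 2.
    by rewrite ler_wpM2r ?sqr_ge0.
  have := sqr_ge0 A; lra.
rewrite ler_pXn2r// ?nnegrE; try lra.
move=> AB.
have : s ^+ 2 * A * (4/5 * A) <= s ^+ 2 * A * B.
  by rewrite ler_wpM2l// mulr_ge0 ?sqr_ge0 ?ltW.
lra.
Qed.

Lemma angles_lt_projection {R : realType} {d : nat} (a : R)
    (X : set 'rV[R]_d) x y z :
  0 < a < pi / 2 -> sin a ^+ 2 <= 10^-1 -> angles_lt (pi / 2 - a) X ->
  X x -> X y -> X z -> x != y -> z != y ->
  9/5 * sin a ^+ 2 * dotp (y - x) (y - x) <= dotp (y - z) (y - x).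
Proof.
move=> ha s2 hX Xx Xy Xz xy zy.
have [<-|xz] := eqVneq x z.
  have := dotp_ge0 (y - x) => ?.
  by rewrite -[leRHS]mul1r ler_wpM2r//; lra.
have s0 : 0 <= sin a.
  by apply: sin_ge0_pi; move: ha; lra.
have [yx yz zx] : [/\ y != x, y != z & z != x].
  by rewrite ![_ == x]eq_sym (eq_sym y z).
have h1 := sin_lt_cosine ha xy zy (hX _ _ _ Xy Xx Xz yx yz xz).
have h2 := sin_lt_cosine ha yx zx (hX _ _ _ Xx Xy Xz xy xz yz).
have h3 := sin_lt_cosine ha xz yz (hX _ _ _ Xz Xx Xy zx zy xy).
have eC (u v : 'rV[R]_d) : enorm (u - v) = enorm (v - u).
  by rewrite /enorm -opprB dotpNl dotpC dotpNl opprK.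
rewrite (eC x y) (eC z y) in h1; rewrite (eC x z) in h3.
rewrite -enorm_sqr.
apply: (@triangle_projection _ (enorm (y - x)) (enorm (z - x)) (enorm (y - z))) => //.
- by rewrite enorm_gt0 ?subr_eq0.
- by rewrite enorm_gt0 ?subr_eq0.
- by rewrite enorm_gt0 ?subr_eq0.
- rewrite !enorm_sqr !dotpBl !dotpBr !(dotpC y) (dotpC z x); lra.
- apply: (le_trans h1); rewrite !dotpBl !dotpBr !(dotpC y) (dotpC z x); lra.
- apply: (le_trans h2); rewrite enorm_sqr !dotpBl !dotpBr !(dotpC y) (dotpC z x); lra.
- apply: (le_trans h3); rewrite enorm_sqr !dotpBl !dotpBr !(dotpC y) (dotpC z x); lra.
Qed.

(** * Counting separated points *)

Lemma bernoulli_ineq {R : realDomainType} (h : R) n :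
  0 <= h -> 1 + h *+ n <= (1 + h) ^+ n.
Proof.
move=> h0; elim: n => [|n IH]; first by rewrite mulr0n addr0 expr0.
rewrite exprS mulrS; apply: le_trans (ler_wpM2l _ IH); last lra.
have : 0 <= h * (h *+ n) by rewrite mulr_ge0 ?mulrn_wge0.
lra.
Qed.

(** Removes the constant from a bound that holds for words of every length. *)
Lemma bounded_powers {R : realType} (r C : R) : (forall n, r ^+ n <= C) -> r <= 1.
Proof.
move=> rC; rewrite leNgt; apply/negP => r1.
have h0 : 0 < r - 1 by lra.
pose n := (Num.truncn (C / (r - 1))).+1.
have := bernoulli_ineq n (ltW h0); rewrite [1 + (r - 1)]addrC subrK => hn.
have : C / (r - 1) < n%:R by apply: truncnS_gt.
rewrite ltr_pdivrMr// mulr_natl => Cn.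
have := rC n; lra.
Qed.

(** Pigeonhole on cubic cells of side [delta]: two points in one cell differ by less than [delta] in
    every coordinate. *)
Lemma grid_count {R : realType} {d : nat} (L : seq 'rV[R]_d) (M delta : R) :
  0 < delta -> 0 <= M -> uniq L ->
  (forall u i, u \in L -> `|u 0 i| <= M) ->
  (forall u v, u \in L -> v \in L -> u != v ->
    exists i, delta <= `|u 0 i - v 0 i|) ->
  (size L)%:R <= (2 * M / delta + 1) ^+ d.
Proof.
move=> d0 M0 uL LM Lsep.
have MD0 : 0 <= 2 * M / delta by rewrite divr_ge0 ?mulr_ge0// ltW.
pose K := Num.truncn (2 * M / delta).
pose cell (u : 'rV[R]_d) i := Num.truncn ((u 0 i + M) / delta).
have cellE u i : u \in L ->
    (cell u i <= K)%N /\
    (cell u i)%:R * delta <= u 0 i + M < (cell u i)%:R * delta + delta.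
  move=> /LM - /(_ i); rewrite ler_norml => /andP[lM uM].
  have c0 : 0 <= (u 0 i + M) / delta by rewrite divr_ge0 ?(ltW d0)//; lra.
  have := truncn_itv c0; rewrite -/(cell u i) => /andP[h1 h2].
  split; first by apply: le_truncn; rewrite ler_pM2r ?invr_gt0//; lra.
  by move: h1 h2; rewrite ler_pdivlMr// ltr_pdivrMr//
    -(addn1 (cell u i)) natrD mulrDl mul1r => -> ->.
pose g u := [ffun i : 'I_d => inord (cell u i) : 'I_K.+1].
have g_inj : {in L &, injective g}.
  move=> u v Lu Lv /ffunP guv; apply/eqP/negPn/negP => /(Lsep u v Lu Lv)[i].
  have [uK hu] := cellE u i Lu; have [vK hv] := cellE v i Lv.
  have : cell u i = cell v i.
    by have /(congr1 val) := guv i; rewrite !ffunE /= !inordK.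
  rewrite leNgt ltr_norml => e; rewrite e in hu; case/negP.
  by apply/andP; split; lra.
have : (size L <= K.+1 ^ d)%N.
  rewrite -(size_map g) -[K.+1 in leqRHS]card_ord -[d in leqRHS]card_ord -card_ffun cardE.
  apply: uniq_leq_size => [|x _]; first by rewrite map_inj_in_uniq.
  by rewrite mem_enum.
rewrite -(ler_nat R) natrX => /le_trans; apply.
apply: lerXn2r; rewrite ?nnegrE ?ler0n ?addr_ge0//.
by rewrite -addn1 natrD lerD2r truncn_le.
Qed.

(** Turns separation along a direction into the coordinate separation of [grid_count]. Finitely many
    directions admit a common [c]. *)
Lemma coord_separation {R : realType} {d : nat} (sg : R) (E : seq 'rV[R]_d) :
  0 < sg -> 0 \notin E ->
  exists2 c, 0 < c & forall e v, e \in E -> sg * dotp e e <= dotp v e ->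
    exists i, c <= `|v 0 i|.
Proof.
move=> sg0; elim: E => [_|e E IH]; first by exists 1.
rewrite inE negb_or eq_sym => /andP[e0 /IH[c c0 Ec]].
have S0 : 0 <= \sum_i `|e 0 i| by apply: sumr_ge0.
have ee0 : 0 < sg * dotp e e by rewrite mulr_gt0 ?dotp_gt0.
pose c' := sg * dotp e e / (1 + \sum_i `|e 0 i|).
have c'0 : 0 < c' by rewrite divr_gt0//; lra.
exists (Num.min c c'); first by rewrite lt_min c0.
move=> f v; rewrite inE => /predU1P[->|/Ec h] le; last first.
  by have [i ci] := h _ le; exists i; rewrite ge_min ci.
have [[i hi]|nh] := pselect (exists i, c' <= `|v 0 i|).
  by exists i; rewrite ge_min hi orbT.
have : dotp v e <= c' * \sum_i `|e 0 i|.
  rewrite mulr_sumr; apply: ler_sum => i _.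
  apply: le_trans (ler_norm _) _; rewrite normrM ler_wpM2r//.
  by rewrite leNgt; apply/negP => /ltW hi; apply: nh; exists i.
have : c' * (1 + \sum_i `|e 0 i|) = sg * dotp e e by rewrite divfK// gt_eqF//; lra.
lra.
Qed.

(** * Words without equal consecutive letters *)

Section Words.
Context {T : eqType}.
Implicit Types (x y : T) (s w : seq T).

Definition head_neq x w := if w is y :: _ then x != y else true.

Fixpoint words s n : seq (seq T) :=
  if n is m.+1 then
    [seq x :: w | w <- words s m, x <- [seq x <- s | head_neq x w]]
  else [:: [::]].

Lemma words_cons s n w : w \in words s n.+1 ->
  exists x v, [/\ w = x :: v, x \in s, head_neq x v & v \in words s n].
Proof.
move=> /allpairsPdep[v [x [vs]]]; rewrite mem_filter => /andP[xv xs] ->.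
by exists x, v.
Qed.

Lemma words_uniq s n : uniq s -> uniq (words s n).
Proof.
move=> us; elim: n => // n IH; apply: allpairs_uniq_dep => // [w _|].
  exact: filter_uniq.
by move=> [w x] [w' x'] /= _ _ [-> ->].
Qed.

(** A word can be prolonged on the left by every letter except its head. *)
Lemma size_words s n : uniq s -> ((size s).-1 ^ n <= size (words s n))%N.
Proof.
move=> us; elim: n => // n IH.
rewrite expnS mulnC /= size_allpairs_dep sumnE big_map.
apply: leq_trans (leq_mul IH (leqnn _)) _.
rewrite -sum1_size big_distrl/=; apply: leq_sum => w _; rewrite mul1n size_filter.
have <- := count_predC (head_neq^~ w) s.
suff : (count (predC (head_neq^~ w)) s <= 1)%N by lia.
case: w => [|y w]; first by rewrite (@eq_count _ _ pred0) ?count_pred0.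
rewrite (@eq_count _ _ (pred1 y)) => [|x /=]; last by rewrite negbK.
by rewrite count_uniq_mem// leq_b1.
Qed.
End Words.

(** * Points attached to words *)

Section Expansion.
Context {R : realType} {d : nat}.
Context (S : seq 'rV[R]_d) (kappa lam : R) (p0 : 'rV[R]_d).
Context (kappa0 : 0 <= kappa) (lam_itv : 0 < lam < 1).
Context (proj : forall x y z, x \in S -> y \in S -> z \in S ->
  x != y -> z != y -> kappa * dotp (y - x) (y - x) <= dotp (y - z) (y - x)).
(** Base case of [expansion_deep]: the empty word has no head, so it needs the stronger bound. *)
Context (p0_deep : forall x y, x \in S -> y \in S -> x != y ->
  (1 + lam)^-1 * (kappa * dotp (y - x) (y - x)) <= dotp (y - p0) (y - x)).

(* The tail [p0] makes the total weight 1, so that the expansion of a finite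
   word is still a convex combination. *)
Definition expansion (w : seq 'rV[R]_d) : 'rV[R]_d :=
  foldr (fun x p => (1 - lam) *: x + lam *: p) p0 w.

(* The constants are the weights that the infinite words [y x y x ...] and
   [x y x y ...] give to the letters other than [y]. *)
Lemma expansion_deep n w x y : w \in words S n -> x \in S -> y \in S -> x != y ->
  lam / (1 + lam) * (kappa * dotp (y - x) (y - x)) <= dotp (y - expansion w) (y - x)
  /\ (head_neq y w ->
    (1 + lam)^-1 * (kappa * dotp (y - x) (y - x)) <= dotp (y - expansion w) (y - x)).
Proof.
move=> + xS yS xy; have /andP[l0 l1] := lam_itv.
set k := kappa * _; have k0 : 0 <= k by rewrite mulr_ge0 ?dotp_ge0.
have i0 : 0 < (1 + lam)^-1 by rewrite invr_gt0; lra.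
have weaken t : (1 + lam)^-1 * k <= t -> lam / (1 + lam) * k <= t.
  apply: le_trans; rewrite ler_wpM2r// -[leRHS]mul1r ler_wpM2r//; lra.
elim: n w => [w|n IH w /words_cons[z [v [-> zS zv /IH[IH1 IH2]]]]].
  by rewrite inE => /eqP ->; split=> [|_]; [apply: weaken|]; apply: p0_deep.
have step : dotp (y - expansion (z :: v)) (y - x)
    = (1 - lam) * dotp (y - z) (y - x) + lam * dotp (y - expansion v) (y - x).
  by rewrite /= !dotpBl dotpDl !dotpZl; ring.
(* If [z = y], only the tail contributes, but it does not start with [y]. Otherwise the weights add
   up by [(1 - lam) + lam^2 / (1 + lam) = 1 / (1 + lam)]. *)
rewrite step; have [zy|zy] := eqVneq z y.
  rewrite /= zy eqxx; split=> //; rewrite subrr dotp0l mulr0 add0r.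
  rewrite -mulrA ler_pM2l//; apply: IH2; by rewrite -zy.
suff h : (1 + lam)^-1 * k <= (1 - lam) * dotp (y - z) (y - x)
    + lam * dotp (y - expansion v) (y - x) by split=> // ; apply: weaken.
have kz := proj xS yS zS xy zy; rewrite -/k in kz.
have -> : (1 + lam)^-1 * k = (1 - lam) * k + lam * (lam / (1 + lam) * k).
  by field; lra.
by apply: lerD; rewrite ler_pM2l//; lra.
Qed.

(** Each common first letter scales the difference by [lam]; at the first distinct letters [x] and
    [y], depth separates the points along [y - x]. *)
Lemma expansion_sep c n w w' :
  (forall x y v, x \in S -> y \in S -> x != y ->
    (2 * lam * (lam / (1 + lam) * kappa) - (2 * lam - 1)) * dotp (y - x) (y - x)
      <= dotp v (y - x) -> exists i, c <= `|v 0 i|) ->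
  0 <= c -> w \in words S n -> w' \in words S n -> w != w' ->
  exists i, c * lam ^+ n <= `|expansion w 0 i - expansion w' 0 i|.
Proof.
move=> csep c0; have /andP[l0 l1] := lam_itv.
elim: n w w' => [w w'|n IH w w']; first by rewrite !inE => /eqP -> /eqP ->; rewrite eqxx.
move=> /words_cons[x [v [-> xS xv vS]]] /words_cons[y [v' [-> yS yv' v'S]]].
have [<-|xy _] := eqVneq x y.
  rewrite eqseq_cons eqxx => /(IH _ _ vS v'S)[i hi]; exists i.
  rewrite /= !mxE opprD addrACA subrr add0r -mulrBr normrM gtr0_norm//.
  by rewrite exprS mulrCA ler_pM2l.
have yx : y != x by rewrite eq_sym.
(* The tail after [x] may start with [y], and conversely, so only the weaker bound is available. *)
have [hy _] := expansion_deep vS xS yS xy.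
have [hx _] := expansion_deep v'S yS xS yx.
have [|i ci] := csep x y (expansion (y :: v') - expansion (x :: v)) xS yS xy.
  move: hx; rewrite -(opprB y x) !dotpNr dotpNl opprK.
  move: hy; rewrite /= !(dotpC _ (y - x)) => hy hx.
  have /andP[m0 m1] : 0 < lam / (1 + lam) < 1.
    by rewrite divr_gt0 ?ltr_pdivrMr; lra.
  set D := dotp (y - x) (y - x) in hx hy *.
  set W := lam / (1 + lam) in hx hy *.
  have : 0 <= lam * (dotp (y - x) (y - expansion v) - W * (kappa * D)).
    by rewrite mulr_ge0 ?(ltW l0)// subr_ge0.
  have : 0 <= lam * (- dotp (y - x) (x - expansion v') - W * (kappa * D)).
    by rewrite mulr_ge0 ?(ltW l0)// subr_ge0.
  have -> : dotp (y - x) ((1 - lam) *: y + lam *: expansion v'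
      - ((1 - lam) *: x + lam *: expansion v))
    = (1 - lam) * D + lam * (dotp (y - x) (y - expansion v)
       - dotp (y - x) (x - expansion v') - D).
    by rewrite /D !(dotpC (y - x)) !(dotpBl, dotpDl, dotpZl); ring.
  lra.
exists i; rewrite distrC; move: ci; rewrite [X in `|X|]mxE [X in _ + X]mxE.
apply: le_trans; rewrite -[leRHS]mulr1 ler_wpM2l// exprn_ile1 ?ltW//.
Qed.

Lemma expansion_bounded M n w i : (forall x, x \in S -> `|x 0 i| <= M) ->
  `|p0 0 i| <= M -> w \in words S n -> `|expansion w 0 i| <= M.
Proof.
move=> SM p0M; have /andP[l0 l1] := lam_itv.
elim: n w => [w|n IH w]; first by rewrite inE => /eqP ->.
move=> /words_cons[x [v [-> xS _ /IH vM]]] /=; rewrite !mxE.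
apply: le_trans (ler_normD _ _) _; rewrite !normrM (gtr0_norm l0).
have /ger0_norm -> : 0 <= 1 - lam by lra.
have -> : M = (1 - lam) * M + lam * M by ring.
apply: lerD; first by rewrite ler_wpM2l ?SM//; lra.
by rewrite ler_wpM2l// ltW.
Qed.

Lemma size_le_expansion : uniq S ->
  2 * lam - 1 < 2 * lam * (lam / (1 + lam) * kappa) ->
  (size S).-1%:R * lam ^+ d <= 1.
Proof.
move=> uS gap; have /andP[l0 l1] := lam_itv.
pose sg := 2 * lam * (lam / (1 + lam) * kappa) - (2 * lam - 1).
have [|/=|c c0 csep] := @coord_separation R d sg
  [seq y - x | y <- S, x <- [seq x <- S | x != y]].
- by rewrite subr_gt0.
- apply/negP => /allpairsPdep[y [x []]].
  by rewrite mem_filter => yS /andP[xy _] /esym/eqP; rewrite subr_eq0 eq_sym (negbTE xy).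
pose M := `|p0| + \sum_(x <- S) `|x|.
have coordM (u : 'rV[R]_d) i : `|u 0 i| <= `|u|.
  by rewrite /Num.norm/= mx_normrE (le_bigmax _ _ (0, i)).
have p0M i : `|p0 0 i| <= M.
  by apply: le_trans (coordM _ _) _; rewrite lerDl sumr_ge0.
have SM i x : x \in S -> `|x 0 i| <= M.
  move=> xS; apply: le_trans (coordM _ _) _.
  by rewrite /M (big_rem x)//= addrCA lerDl addr_ge0// sumr_ge0.
have M0 : 0 <= M by rewrite addr_ge0// sumr_ge0.
(* Counting the words of length [n] and multiplying by [lam^(n d)] gives [((|S| - 1) lam^d)^n <= (2
   M / c + lam^n)^d]. *)
apply: (@bounded_powers _ _ ((2 * M / c + 1) ^+ d)) => n.
have ln0 : 0 < lam ^+ n by rewrite exprn_gt0.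
have sep w w' : w \in words S n -> w' \in words S n -> w != w' ->
    exists i, c * lam ^+ n <= `|expansion w 0 i - expansion w' 0 i|.
  apply: expansion_sep (ltW c0) => x y v xS yS xy.
  apply: csep; apply/allpairsPdep; exists y, x.
  by rewrite mem_filter xy xS yS.
have inj : {in words S n &, injective expansion}.
  move=> w w' wS w'S e; apply/eqP/negPn/negP => /(sep _ _ wS w'S)[i].
  by rewrite e subrr normr0 leNgt mulr_gt0.
have cnt : (size (words S n))%:R <= (2 * M / (c * lam ^+ n) + 1) ^+ d.
  rewrite -(size_map expansion); apply: grid_count => //.
  - exact: mulr_gt0.
  - by rewrite map_inj_in_uniq ?words_uniq.
  - by move=> u i /mapP[w wS ->]; apply: expansion_bounded (SM i) (p0M i) wS.
  - move=> u v /mapP[w wS ->] /mapP[w' w'S ->] ww'; apply: sep => //.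
    by apply: contra ww' => /eqP ->.
rewrite exprMn exprAC.
have sz : (size S).-1%:R ^+ n <= (size (words S n))%:R :> R.
  by rewrite -natrX ler_nat size_words.
apply: (le_trans (ler_wpM2r _ (le_trans sz cnt))); first by rewrite exprn_ge0// ltW.
rewrite -exprMn; apply: lerXn2r; rewrite ?nnegrE.
- by rewrite mulr_ge0 ?(ltW ln0)// addr_ge0// divr_ge0 ?mulr_ge0// ltW.
- by rewrite addr_ge0// divr_ge0 ?mulr_ge0// ltW.
have -> : (2 * M / (c * lam ^+ n) + 1) * lam ^+ n = 2 * M / c + lam ^+ n.
  by field; rewrite !gt_eqF.
by rewrite lerD2l exprn_ile1 ?ltW.
Qed.
End Expansion.

(** * Bounds on the size of the set *)

Lemma size_le_projection {R : realType} {d : nat} (S : seq 'rV[R]_d) (kappa g : R) :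
  0 <= kappa -> 0 < g < 1 -> g < 2/3 * kappa -> uniq S ->
  (forall x y z, x \in S -> y \in S -> z \in S ->
    x != y -> z != y -> kappa * dotp (y - x) (y - x) <= dotp (y - z) (y - x)) ->
  (size S)%:R <= 1 + (2 - g) ^+ d.
Proof.
move=> k0 /andP[g0 g1] gk uS proj.
have [S3|S3] := ltnP (size S) 3.
  have : (size S)%:R <= 2%:R :> R by rewrite ler_nat.
  have : 1 <= (2 - g) ^+ d by apply: exprn_ege1; lra.
  lra.
have lE : 2 - g != 0 by rewrite gt_eqF//; lra.
have [l1 l2] : (2 - g)^-1 < 1 /\ 2^-1 < (2 - g)^-1.
  by rewrite invf_lt1 ?ltf_pV2 ?posrE; lra.
have lam_itv : 0 < (2 - g)^-1 < 1 by rewrite l1 invr_gt0; lra.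
have [a [b [c [aS bS cS [ab ac bc]]]]] : exists a b c, [/\ a \in S, b \in S, c \in S
    & [/\ a != b, a != c & b != c]].
  case: S S3 uS {proj} => [|a [|b [|c s]]]// _ /=.
  rewrite !inE !negb_or => /andP[/and3P[ab ac _] /andP[/andP[bc _] _]].
  by exists a, b, c; rewrite !inE !eqxx !orbT.
(* The weight 2/3 of the points other than a given one is at least
   [(1 + lam)^-1], as [lam >= 1/2]. *)
pose p0 := 3^-1 *: (a + b + c).
have := @size_le_expansion _ _ S kappa (2 - g)^-1 p0 k0 lam_itv proj.
move=> /(_ _ uS) h.
have -> : (size S)%:R = 1 + (size S).-1%:R :> R by rewrite nat1r (ltn_predK S3).
rewrite lerD2l; rewrite exprVn ler_pdivrMr ?mul1r in h; last by rewrite exprn_gt0//; lra.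
apply: h.
- move=> x y xS yS xy; set k := kappa * _.
  have kk : 0 <= k by rewrite mulr_ge0 ?dotp_ge0.
  have step : dotp (y - p0) (y - x)
      = 3^-1 * (dotp (y - a) (y - x) + dotp (y - b) (y - x) + dotp (y - c) (y - x)).
    by rewrite /p0 !(dotpDl, dotpNl, dotpZl); field.
  have fy : dotp (y - y) (y - x) = 0 by rewrite subrr dotp0l.
  have f z : z \in S -> z != y -> k <= dotp (y - z) (y - x) by move=> ? ?; apply: proj.
  (* At most one of the three points equals [y]; each of the others contributes at least [k]. *)
  have : 2 * k <= dotp (y - a) (y - x) + dotp (y - b) (y - x) + dotp (y - c) (y - x).
    have [ya|ya] := eqVneq a y.
      subst a; have := f b bS; have := f c cS; rewrite fy ![_ == y]eq_sym ab ac.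
      by move=> /(_ isT) ? /(_ isT) ?; lra.
    have [yb|yb] := eqVneq b y.
      subst b; have := f a aS ab; have := f c cS; rewrite fy (eq_sym c) bc.
      by move=> /(_ isT) ? ?; lra.
    have [yc|yc] := eqVneq c y.
      by subst c; have := f a aS ac; have := f b bS bc; rewrite fy; lra.
    by have := f a aS ya; have := f b bS yb; have := f c cS yc; lra.
  rewrite step; have : (1 + (2 - g)^-1)^-1 <= 2/3.
    by rewrite -[leRHS]invrK lef_pV2 ?posrE; lra.
  move=> /(ler_wpM2r kk); lra.
(* For [lam = 1 / (2 - g)] the gap condition reads [g < 2 lam / (1 + lam) * kappa], and
   [lam / (1 + lam) >= 1/3]. *)
- have -> : 2 * (2 - g)^-1 - 1 = (2 - g)^-1 * g by field.
  rewrite -mulrA mulrCA ltr_pM2l; last lra.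
  apply: (lt_le_trans gk); rewrite [leRHS]mulrA ler_wpM2r//.
  suff : 3^-1 <= (2 - g)^-1 / (1 + (2 - g)^-1) by lra.
  rewrite ler_pdivlMr; lra.
Qed.

Lemma maxsize_le {R : realType} (d : nat) (a g : R) :
  0 < a < pi / 2 -> sin a ^+ 2 <= 10^-1 -> 0 < g -> g < 6/5 * sin a ^+ 2 ->
  (maxsize d (pi / 2 - a) <= (1 + (2 - g) ^+ d)%:E)%E.
Proof.
move=> ha s2 g0 gs; apply: ge_ereal_sup => _ [X hX <-].
have fin (B : seq 'rV[R]_d) : uniq B -> (forall x, x \in B -> X x) ->
    (size B)%:R <= 1 + (2 - g) ^+ d.
  move=> uB BX; apply: (@size_le_projection _ _ _ (9/5 * sin a ^+ 2)) => //.
  - by have := sqr_ge0 (sin a); lra.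
  - by lra.
  - by lra.
  by move=> x y z xB yB zB; apply: (angles_lt_projection ha s2 hX); apply: BX.
rewrite /counting; case: asboolP => [fX|/(infinite_set_fset)].
  rewrite lee_fin; apply: fin => [|x]; first exact: finmap.fset_uniq.
  by rewrite in_fset_set// inE.
(* An infinite [X] would contain finite subsets larger than the bound. *)
move=> /(_ (Num.truncn (1 + (2 - g) ^+ d)).+1) [B BX leB].
have := fin _ (finmap.fset_uniq B) BX; rewrite leNgt => /negP[].
by apply: lt_le_trans (truncnS_gt _) _; rewrite ler_nat.
Qed.

(** * Small angles and large dimensions *)

Lemma sin_near0 {R : realType} (e : R) : 0 < e -> exists2 a0, 0 < a0 &
  forall a, 0 < a < a0 -> (1 - e) * a < sin a < (1 + e) * a.
Proof.
move=> e0.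
have [_ D] := is_derive_sin (0 : R).
have := @derivable_sin R 0; rewrite /derivable -/(derive sin 0 1) => /cvg_ex[l hl].
have l1 : l = 1 by rewrite -(cos0 R) -D; apply/esym/cvg_lim.
move/cvgrPdist_lt : hl => /(_ e e0) [r /= r0 hr]; exists r => // a /andP[a0 ar].
have := hr a; rewrite /= sub0r normrN gtr0_norm// => /(_ ar (lt0r_neq0 a0)).
rewrite [a *: _]mulr1 sin0 subr0 l1 addr0 => h.
have : `|(1 - a^-1 * sin a) * a| < e * a by rewrite normrM (gtr0_norm a0) ltr_pM2r.
rewrite mulrBl mul1r mulrAC mulVf ?gt_eqF// mul1r ltr_norml => /andP[? ?].
by apply/andP; split; lra.
Qed.

(** Absorbs the additive 1 of the size bound into a slightly larger base: by Bernoulli,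
    [(1 + h / c)^d >= 2]. *)
Lemma add1_expr_le {R : realFieldType} (c h : R) d :
  1 <= c -> 0 <= h -> c <= h *+ d -> 1 + c ^+ d <= (c + h) ^+ d.
Proof.
move=> c1 h0 ch; have c0 : 0 < c by lra.
have -> : c + h = c * (1 + h / c) by field; rewrite gt_eqF.
have : 1 + (h / c) *+ d <= (1 + h / c) ^+ d.
  by apply: bernoulli_ineq; rewrite divr_ge0// ltW.
have : 1 <= (h / c) *+ d by rewrite -mulrnAl ler_pdivlMr// mul1r.
rewrite exprMn => h1 h2.
have cd1 : 1 <= c ^+ d by apply: exprn_ege1.
have : c ^+ d * 2 <= c ^+ d * (1 + h / c) ^+ d by rewrite ler_wpM2l//; lra.
lra.
Qed.

Lemma growth_le {R : realType} (beta b : R) : 0 <= b -> 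
  (\forall d \near \oo%classic, (maxsize d beta <= (b ^+ d)%:E)%E) ->
  (growth beta <= b%:E)%E.
Proof.
move=> b0 [N _ hN].
(* The strict inequality excludes [d = 0], where the root would not undo the power. *)
pose V := [set d | (N < d)%N]%classic.
have VN : (\oo%classic : set_system nat) V by exists N.+1.
apply: le_trans (ereal_inf_lbound _) _; first by exists V; [exact: VN|reflexivity].
apply: ge_ereal_sup => _ [d /= Nd <-].
have d0 : d%:R != 0 :> R by rewrite pnatr_eq0 -lt0n; apply: leq_ltn_trans Nd.
have dV : 0 <= d%:R^-1 :> R by rewrite invr_ge0 ler0n.
have max0 : (0 <= maxsize d beta)%E.
  apply: ereal_sup_ubound; exists set0 => [x y z []|].
  by rewrite /counting asboolT// fset_set0.
apply: le_trans (gt0_ler_poweR dV _ _ (hN d (ltnW Nd))) _.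
- by rewrite in_itv /= max0 leey.
- by rewrite in_itv /= lee_fin exprn_ge0// leey.
by rewrite poweR_EFin -powR_mulrn// -powRrM divff// powRr1.
Qed.

Theorem theorem2 (R : realType) :
  exists alpha0 : R, 0 < alpha0 /\
    forall alpha : R, 0 < alpha -> alpha < alpha0 ->
      (growth (pi / 2 - alpha) <= (2 - alpha ^+ 2)%:E)%E.
Proof.
(* The error 1/25 ensures [6/5 * (24/25)^2 > 21/20], so that [g] below is admissible; [a < 3/10]
   ensures [(26/25 * a)^2 < 10^-1]. *)
have [a0 a0_gt0 sin_a0] := @sin_near0 R (1/25) ltac:(lra).
exists (Num.min a0 (3/10)); split; first by rewrite lt_min a0_gt0; lra.
move=> a a_gt0; rewrite lt_min => /andP[aa0 a3].
have /andP[s1 s2] := sin_a0 a ltac:(by rewrite a_gt0 aa0).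
have pi2 := pi_ge2 R.
have a2 : 0 < a ^+ 2 by rewrite exprn_gt0.
have a2le : a ^+ 2 <= 9/100.
  have : a ^+ 2 <= (3/10) ^+ 2 by rewrite ler_pXn2r ?nnegrE//; lra.
  lra.
have sle : sin a ^+ 2 <= (26/25 * a) ^+ 2.
  by rewrite ler_pXn2r ?nnegrE//; lra.
have sge : (24/25 * a) ^+ 2 <= sin a ^+ 2.
  by rewrite ler_pXn2r ?nnegrE//; lra.
apply: growth_le; first lra.
(* The bases differ by [a^2 / 20], and [d > 40 / a^2] makes [d] times this exceed 2. *)
exists (Num.truncn (40 / a ^+ 2)).+1 => // d /= Nd.
pose g := 21/20 * a ^+ 2.
have h : (maxsize d (pi / 2 - a) <= (1 + (2 - g) ^+ d)%:E)%E.
  by apply: maxsize_le; rewrite /g; lra.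
apply: (le_trans h); rewrite lee_fin.
have -> : 2 - a ^+ 2 = (2 - g) + a ^+ 2 / 20 by rewrite /g; field.
apply: add1_expr_le; rewrite /g; try lra.
have : 40 / a ^+ 2 < d%:R.
  by apply: lt_le_trans (truncnS_gt _) _; rewrite ler_nat.
rewrite ltr_pdivrMr// -[_ *+ d]mulr_natr; lra.
Qed.
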